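(* Let $n\ge d\ge 1$ be integers. For any monic degree-$d$ polynomial $p(x)=x^d+\sum_{i=1}^d a_{2i}x^{d-i}$ and any $t\ge 0$, the coefficients of $p(x,t)=\big(p\boxplus_d^n G_{n,d}^{[t]}\big)(x)$ are given explicitly by $$p(x,t)=x^d+\sum_{k=1}^d\sum_{j=0}^k\frac{(-2)^j}{j!}\,\frac{(d-k+j)!}{(d-k)!}\,\frac{(n+d-k+j)!}{(n+d-k)!}\,a_{2(k-j)}\,t^j x^{d-k},$$ where $a_0=1$.
   Context: Rectangular convolution: for monic degree-$d$ polynomials $p(x)=x^d+\sum_{i=1}^d a_{2i}x^{d-i}$ and $q(x)=x^d+\sum_{i=1}^d b_{2i}x^{d-i}$, with $a_0=b_0=1$, the $(n,d)$-rectangular finite free convolution is $$(p\boxplus_d^n q)(x)=x^d+\sum_{k=1}^d x^{d-k}\sum_{\substack{i,j\ge 0\\ i+j=k}}\frac{(d-i)!(d-j)!}{d!(d-k)!}\,\frac{(n+d-i)!(n+d-j)!}{(n+d)!(n+d-k)!}\,a_{2i}b_{2j}.$$ Laguerre heat polynomials: with $m^{\downarrow k}=m(m-1)\cdots(m-k+1)$ for $k\ge 1$ and $m^{\downarrow 0}=1$, let $L_d^{(\alpha)}(x)=\sum_{k=0}^d\frac{(d+\alpha)^{\downarrow k}}{(d-k)!\,k!}(-x)^{d-k}$. For $t>0$ set $G_{n,d}^{[t]}(x)=(-2t)^d\, d!\, L_d^{(n)}\!\left(\frac{x}{2t}\right)$, and $G_{n,d}^{[0]}(x)=x^d$ (the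 value at $t=0$ of the resulting polynomial expression in $x$ and $t$). *)

(* Defs.v *)
From HB Require Import structures.
From mathcomp Require Import all_boot all_order all_algebra.

Set Implicit Arguments.
Unset Strict Implicit.
Unset Printing Implicit Defensive.

Import Order.TTheory GRing.Theory Num.Theory.
Local Open Scope ring_scope.

(* The coefficient of x^(d - i) in p, written a_{2i} in the literature when p
   is monic of degree d; only meaningful for i <= d. *)
Definition evcoef (R : nzRingType) (d : nat) (p : {poly R}) (i : nat) : R :=
  p`_(d - i).

(* The (n, d)-rectangular finite free convolution; only meaningful for p and q
   monic of degree d. The inner sum over i + j = k is indexed by i, j = k - i. *)
Definition rect_conv (R : fieldType) (n d : nat) (p q : {poly R}) : {poly R} :=
  'X^d + \sum_(1 <= k < d.+1)
    (\sum_(0 <= i < k.+1)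
       let j := (k - i)%N in
       ((d - i)`!%:R * (d - j)`!%:R) / (d`!%:R * (d - k)`!%:R)
       * (((n + d - i)`!%:R * (n + d - j)`!%:R)
          / ((n + d)`!%:R * (n + d - k)`!%:R))
       * evcoef d p i * evcoef d q j) *: 'X^(d - k).

Definition falling (R : nzRingType) (m : R) (k : nat) : R :=
  \prod_(0 <= i < k) (m - i%:R).

Definition laguerre (R : fieldType) (d : nat) (alpha : R) : {poly R} :=
  \sum_(0 <= k < d.+1)
    (falling (d%:R + alpha) k / ((d - k)`!%:R * k`!%:R)) *: (- 'X) ^+ (d - k).

(* The case t = 0 is separate because x / (2t) is not meaningful there: with
   0^-1 = 0 the general formula would give 0 instead of x^d. *)
Definition laguerre_heat (R : fieldType) (n d : nat) (t : R) : {poly R} :=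
  if t == 0 then 'X^d
  else ((- (2 * t)) ^+ d * d`!%:R)
         *: (laguerre d n%:R \Po ((2 * t)^-1 *: 'X)).

(* Main.v *)
Require Import Defs.
From HB Require Import structures.
From mathcomp Require Import all_boot all_order all_algebra.
From mathcomp Require Import ring.

Set Implicit Arguments.
Unset Strict Implicit.
Unset Printing Implicit Defensive.

Import Order.TTheory GRing.Theory Num.Theory.
Local Open Scope ring_scope.

(** Both sides are polynomials written out in the monomials x^(d-k), so the
    identity is one between coefficients.  The coefficient of x^(d-j) in the
    Laguerre heat polynomial is
    [(-2t)^j / j! * d! / (d-j)! * (n+d)! / (n+d-j)!]
    ([coef_laguerre_heat]).  The two quotients of factorials are exactly the
    inverses of the factors by which the convolution weights the coefficient
    of index j of its second argument, so after substitution everything that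
    depends on j through q cancels except [(-2t)^j / j!].  What survives of the
    weight belongs to the index i = k - j of p, and reversing the inner sum to
    run over j gives the stated formula. *)

Lemma fact_natr_neq0 (R : numDomainType) (m : nat) : m`!%:R != 0 :> R.
Proof. by rewrite pnatr_eq0 -lt0n fact_gt0. Qed.

Lemma falling_natr (R : numFieldType) (m k : nat) : (k <= m)%N ->
  falling (m%:R : R) k = m`!%:R / (m - k)`!%:R.
Proof.
move=> km; rewrite -(ffact_fact km) natrM mulfK ?fact_natr_neq0 //.
rewrite ffact_prod natr_prod /falling big_mkord.
by apply: eq_bigr => i _; rewrite natrB // (leq_trans (ltnW (ltn_ord i))).
Qed.

(** Exactly one term of the Laguerre sum, the one with k = j, has degree d - j:
    truncated subtraction d - k is injective on k <= d.  Substituting c x for x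
    in (-x)^(d-j) then gives the factor (-c)^(d-j). *)
Lemma coef_laguerre_comp_scaleX (R : fieldType) (d : nat) (alpha c : R)
    (j : nat) : (j <= d)%N ->
  (laguerre d alpha \Po (c *: 'X))`_(d - j) =
  falling (d%:R + alpha) j / ((d - j)`!%:R * j`!%:R) * (- c) ^+ (d - j).
Proof.
move=> jd; rewrite /laguerre linear_sum /= big_mkord coef_sum.
have coef_term k : ((falling (d%:R + alpha) k / ((d - k)`!%:R * k`!%:R)
      *: (- 'X) ^+ (d - k)) \Po (c *: 'X))`_(d - j) =
    falling (d%:R + alpha) k / ((d - k)`!%:R * k`!%:R)
      * ((- c) ^+ (d - k) * (d - j == d - k)%N%:R).
  rewrite comp_polyZ [_ ^+ _ \Po _]rmorphXn /= [- 'X \Po _]raddfN /=.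
  by rewrite comp_polyX -scaleNr exprZn !coefZ coefXn.
rewrite (bigD1 (Ordinal (jd : (j < d.+1)%N))) //= big1 => [|k kj].
  by rewrite addr0 coef_term eqxx mulr1.
rewrite coef_term; case: eqP => [/eqP e|_]; last by rewrite !mulr0.
case/eqP: kj; apply: val_inj; apply/eqP.
by rewrite /= -(eqn_sub2lE (leq_ord k) jd) eq_sym.
Qed.

(** The powers of 2t combine to (2t)^d / (2t)^(d-j) = (2t)^j, so the formula is
    polynomial in t.  At t = 0 it vanishes for j > 0 and equals 1 for j = 0, as
    the coefficients of x^d do. *)
Lemma coef_laguerre_heat (R : numFieldType) (n d j : nat) (t : R) :
  (j <= d)%N ->
  (laguerre_heat n d t)`_(d - j) =
  (- (2 * t)) ^+ j / j`!%:R * (d`!%:R / (d - j)`!%:R)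
    * ((n + d)`!%:R / (n + d - j)`!%:R).
Proof.
move=> jd; rewrite /laguerre_heat; have [-> | t0] := eqVneq t 0.
  rewrite coefXn mulr0 oppr0; case: j jd => [|j] jd.
    by rewrite !subn0 eqxx expr0 fact0 !divff ?fact_natr_neq0 ?oner_eq0 ?mulr1.
  by rewrite expr0n /= !mul0r; case: eqP => // e; have := ltn_subrL j.+1 d;
     rewrite e ltnn /= (leq_trans _ jd).
rewrite coefZ coef_laguerre_comp_scaleX // -natrD falling_natr; last first.
  by rewrite (leq_trans jd) ?leq_addr.
rewrite (addnC d n).
have t20 : - (2 * t) != 0 by rewrite oppr_eq0 mulf_neq0 ?pnatr_eq0.
(* (-2t)^d = (-2t)^j (-2t)^(d-j), whose last factor cancels the one coming
   from the substitution. *)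
rewrite -invrN exprVn -[X in _ ^+ X * d`!%:R](subnKC jd) exprD.
have f0 := fact_natr_neq0 R; field.
by rewrite !f0 expf_neq0.
Qed.

Theorem corollary2p2 (R : numFieldType) (n d : nat)
    (hd : (1 <= d)%N) (hnd : (d <= n)%N)
    (p : {poly R}) (p_monic : p \is monic) (p_deg : size p = d.+1)
    (t : R) (ht : 0 <= t) :
  rect_conv n d p (laguerre_heat n d t) =
  'X^d + \sum_(1 <= k < d.+1) \sum_(0 <= j < k.+1)
    ((-2) ^+ j / j`!%:R
     * ((d - k + j)`!%:R / (d - k)`!%:R)
     * ((n + d - k + j)`!%:R / (n + d - k)`!%:R)
     * evcoef d p (k - j) * t ^+ j) *: 'X^(d - k).
Proof.
rewrite /rect_conv; congr (_ + _); apply: eq_big_nat => k /andP[_ kd].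
rewrite -scaler_suml; congr (_ *: _).
rewrite big_nat_rev /=; apply: eq_big_nat => j /andP[_ jk].
rewrite add0n subSS subKn // [X in _ * X = _]coef_laguerre_heat; last first.
  exact: leq_trans jk kd.
rewrite ltnS in kd; rewrite ltnS in jk.
have knd : (k <= n + d)%N by rewrite (leq_trans kd) ?leq_addl.
rewrite !subnA // -mulNr exprMn.
have f0 := fact_natr_neq0 R.
by field; rewrite !f0.
Qed.
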